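(* For every finite simple graph $G$ there exist diffusion parameters $\Delta$ on $G$ such that the spectral polynomial $P(X,Y)=P_G^{\Delta}(X,Y)$ has the following property: for every diffusion pair $(G',\Delta')$, with spectral polynomial $P'(X,Y)=P_{G'}^{\Delta'}(X,Y)$, $$P(X,Y)=P'(X,Y)\quad\Longleftrightarrow\quad (G,\Delta)\cong(G',\Delta').$$ In other words, the isomorphism class of $G$ is the unique family of graphs having spectral polynomial $P(X,Y)$.
   Context: Graphs are finite, simple and undirected. A diffusion pair $(G,\Delta)$ is a graph $G$ with vertex set $V(G)$ and edge set $E(G)$ together with diffusion parameters $\Delta\colon E(G)\to\{1,2,3,\dots\}$, $e\mapsto\alpha_e$; equivalently, a graph whose edge $e$ carries the weight $Y^{\alpha_e}$, $Y$ an indeterminate. Let $L_G^\Delta(Y)$ be the weighted Laplacian matrix: for vertices $a\neq b$ its $(a,b)$ entry is $-Y^{\alpha_{ab}}$ if $ab$ is an edge and $0$ otherwise, and its $(a,a)$ entry is the sum of $Y^{\alpha_e}$ over all edges $e$ incident to $a$. The spectral polynomial is $P_G^\Delta(X,Y)=\det\bigl(X\cdot I-L_G^\Delta(Y)\bigr)\in\mathbb{Z}[X,Y]$. An isomorphism $(G,\Delta)\cong(G',\Delta')$ of diffusion pairs is a graph isomorphism $G\to G'$ that preserves the diffusion parameters of edges. *)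

(* Defs.v *)
From mathcomp Require Import all_boot all_order all_algebra.

Set Implicit Arguments.
Unset Strict Implicit.
Unset Printing Implicit Defensive.

Import GRing.Theory.
Local Open Scope ring_scope.

Record sgraph := SGraph {
  vertex :> finType;
  adj : rel vertex;
  adj_sym : symmetric adj;
  adj_irrefl : irreflexive adj
}.

Definition edges (G : sgraph) : {set {set G}} :=
  [set e | [exists x, exists y, adj x y && (e == [set x; y])]].

(* The values of [param] outside [edges G] are irrelevant: neither the
   Laplacian nor the notion of isomorphism below depends on them. *)
Record diffusion (G : sgraph) := Diffusion {
  param :> {set G} -> nat;
  param_gt0 : forall e, e \in edges G -> (0 < param e)%N
}.

Definition lap_entry (G : sgraph) (D : diffusion G) (a b : G) : {poly int} :=
  if a == b then \sum_(e in edges G | a \in e) 'X^(D e)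
  else if adj a b then - 'X^(D [set a; b])
  else 0.

(* Rows and columns follow the enumeration of the vertices; here 'X is the
   indeterminate Y. *)
Definition laplacian (G : sgraph) (D : diffusion G) : 'M[{poly int}]_#|G| :=
  \matrix_(i < #|G|, j < #|G|) lap_entry D (enum_val i) (enum_val j).

(* Z[X, Y] is represented as Z[Y][X]: the outer variable is X, the inner is Y. *)
Definition spectral_poly (G : sgraph) (D : diffusion G) : {poly {poly int}} :=
  char_poly (laplacian D).

Definition diffusion_iso (G G' : sgraph) (D : diffusion G) (D' : diffusion G')
    : Prop :=
  exists f : G -> G',
    [/\ bijective f,
        forall x y, adj (f x) (f y) = adj x y
      & forall e, e \in edges G -> D' (f @: e) = D e].

(* Main.v *)
Require Import Defs.
From mathcomp Require Import all_boot all_order all_algebra.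
From mathcomp Require Import perm zify ring.

(** Give the edges of [G] the parameters [2 ^ 0], [2 ^ 1], [2 ^ 2], ...  The trace
    of the Laplacian is [\sum_e 2 Y^(D e)], so a graph with the same spectral
    polynomial has the same parameters, and its edges are matched with those
    of [G].  Writing the Laplacian as [B W B^T], with [B] a signed incidence
    matrix and [W] the diagonal matrix of weights, [P(1, Y) = det (1 - W K)]
    with [K = B^T B].  It is multilinear in the weights, and subset sums of
    powers of two are distinct, so its coefficients are the principal minors
    of [K] up to sign.  The minors of size 2 tell which pairs of edges meet; those of
    size 3 separate three edges at a vertex (minor 4) from a triangle (minor 0).
    Hence, for every set [S] of edges, the number of vertices lying on all
    edges of [S] is the same in both graphs; by inclusion-exclusion, so is the
    number of vertices whose set of incident edges is exactly [S], and any
    vertex bijection preserving these sets is an isomorphism. *)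

Set Implicit Arguments.
Unset Strict Implicit.
Unset Printing Implicit Defensive.

Import GRing.Theory Num.Theory.
Local Open Scope ring_scope.

(** * Subset sums of powers of two *)

(** Induction on [m]: the parity of the sum is the lowest bit, and half of the sum encodes the
    remaining ones. *)
Lemma bits_inj m (f g : nat -> bool) :
  (\sum_(i < m) f i * 2 ^ i = \sum_(i < m) g i * 2 ^ i)%N ->
  forall i, (i < m)%N -> f i = g i.
Proof.
elim: m f g => [|m IHm] f g; first by [].
have E (h : nat -> bool) : (\sum_(i < m.+1) h i * 2 ^ i =
            h 0 + (\sum_(i < m) h i.+1 * 2 ^ i).*2)%N.
  rewrite big_ord_recl muln1 -mul2n big_distrr /=; congr (_ + _)%N.
  by apply: eq_bigr => i _; rewrite /bump add1n expnS mulnCA.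
rewrite !E => eq_fg [_|i lt_im].
  by have := congr1 odd eq_fg; rewrite !oddD !odd_double !addbF !oddb.
apply: (IHm (fun j => f j.+1) (fun j => g j.+1)) => //.
by have := congr1 half eq_fg; rewrite !half_bit_double.
Qed.

Lemma subset_sum_expn2_inj m :
  injective (fun S : {set 'I_m} => \sum_(i in S) 2 ^ i)%N.
Proof.
move=> S T eqST; apply/setP=> i.
pose f (A : {set 'I_m}) k := if insub k is Some j then j \in A else false.
have fE A (j : 'I_m) : f A j = (j \in A) by rewrite /f valK.
have sumE (A : {set 'I_m}) : (\sum_(i in A) 2 ^ i = \sum_(j < m) f A j * 2 ^ j)%N.
  by rewrite big_mkcond; apply: eq_bigr => j _; rewrite fE; case: (j \in A); lia.
rewrite -!fE; apply: (@bits_inj m); last exact: ltn_ord.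
by rewrite -!sumE.
Qed.

(** * Determinants and characteristic polynomials *)

(** Sylvester's identity: multiplying [L] by a unitriangular block matrix on the right or on the
    left clears one off-diagonal block, leaving a different nontrivial diagonal block each time. *)
Lemma det_1_plus_mulmxC (R : comNzRingType) m n (A : 'M[R]_(m, n)) (B : 'M_(n, m)) :
  \det (1%:M + A *m B) = \det (1%:M + B *m A).
Proof.
pose L := block_mx 1%:M (- A) B 1%:M.
have detL1 : \det (L *m block_mx 1%:M A 0 1%:M) = \det (1%:M + B *m A).
  rewrite mulmx_block !mulmx1 !mul1mx !mulmx0 !addr0 subrr det_lblock det1 mul1r.
  by rewrite addrC.
have detL2 : \det (block_mx 1%:M A 0 1%:M *m L) = \det (1%:M + A *m B).
  rewrite mulmx_block !mulmx1 !mul1mx !mul0mx !add0r addNr det_lblock det1 mulr1.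
  by [].
by rewrite -detL1 -detL2 !det_mulmx mulrC.
Qed.

Lemma mxtrace_char_poly (R : nzRingType) n (A B : 'M[R]_n) :
  char_poly A = char_poly B -> \tr A = \tr B.
Proof.
case: n A B => [|n] A B eqAB; first by rewrite /mxtrace !big_ord0.
by apply: oppr_inj; rewrite -!char_poly_trace ?eqAB.
Qed.

Lemma char_poly_dim (R : nzRingType) n n' (A : 'M[R]_n) (B : 'M[R]_n') :
  char_poly A = char_poly B -> n = n'.
Proof. by move/(congr1 (fun p : {poly R} => size p)); rewrite !size_char_poly => -[]. Qed.

Lemma horner_char_poly (R : comNzRingType) n (A : 'M[R]_n) x :
  (char_poly A).[x] = \det (x%:M - A).
Proof.
rewrite -[LHS]/(horner_eval x _) -det_map_mx; congr (\det _).
by apply/matrixP=> i j; rewrite !mxE raddfB raddfMn /= horner_evalE hornerX horner_evalE hornerC.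
Qed.

Lemma char_poly_reindex (R : comNzRingType) n n' (A : 'M[R]_n) (B : 'M[R]_n')
    (h : 'I_n -> 'I_n') :
  bijective h -> (forall i j, B (h i) (h j) = A i j) -> char_poly A = char_poly B.
Proof.
move=> bij_h; have eq_n : n = n' by have := bij_eq_card bij_h; rewrite !card_ord.
(* Once the two sizes are identified, [h] is a permutation, and the matrices are conjugate by its
   permutation matrix. *)
case: n' / eq_n h bij_h B => h bij_h B AB; have inj_h := bij_inj bij_h.
pose s := perm inj_h.
have -> : A = perm_mx s *m B *m (perm_mx s)^T.
  rewrite tr_perm_mx -col_permE -row_permE.
  by apply/matrixP=> i j; rewrite !mxE !permE AB.
have perm1 : perm_mx s *m (perm_mx s)^T = 1%:M :> 'M[R]_n.
  by rewrite tr_perm_mx -perm_mxM mulgV perm_mx1.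
rewrite /char_poly /char_poly_mx !map_mxM.
set P := map_mx _ (perm_mx s); set P' := map_mx _ _^T.
have PP' : P *m P' = 1%:M by rewrite -map_mxM perm1 map_mx1.
have -> : 'X%:M - P *m map_mx polyC B *m P' = P *m ('X%:M - map_mx polyC B) *m P'.
  by rewrite mulmxBr mulmxBl scalar_mxC -(mulmxA _ P) PP' mulmx1.
by rewrite !det_mulmx mulrAC -det_mulmx PP' det1 mul1r.
Qed.

(** * Principal minors as coefficients *)

(* [row_mix K S] is the identity plus a product of an [m x #|S|] and an
   [#|S| x m] matrix, so [det_1_plus_mulmxC] reduces its determinant to a minor. *)
Definition row_mix (R : pzRingType) m (K : 'M[R]_m) (S : {set 'I_m}) : 'M[R]_m :=
  \matrix_(i, j) (if i \in S then - K i j else (i == j)%:R).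

Lemma det_row_mix (R : comNzRingType) m r (K : 'M[R]_m) (t : 'I_r -> 'I_m) :
  injective t ->
  \det (row_mix K (t @: setT)) = \det (- mxsub t t K).
Proof.
move=> inj_t.
(* Adding [P *m Q] to the identity replaces row [t a] by minus that row of [K]; in [Q *m P] the
   subtracted Kronecker deltas give minus the identity, which cancels. *)
pose P : 'M[R]_(m, r) := \matrix_(i, a) (i == t a)%:R.
pose Q : 'M[R]_(r, m) := \matrix_(a, j) (- K (t a) j - (t a == j)%:R).
have -> : row_mix K (t @: setT) = 1%:M + P *m Q.
  apply/matrixP=> i j; rewrite !mxE; case: ifP => [/imsetP[a _ ->]|iS].
    rewrite (bigD1 a) //= !mxE eqxx mul1r big1 ?addr0; last first.
      by move=> b ba; rewrite mxE (inj_eq inj_t) eq_sym (negPf ba) mul0r.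
    by rewrite addrC subrK.
  rewrite big1 ?addr0 // => a _; rewrite !mxE.
  by case: eqP iS => [->|_ _]; rewrite ?mul0r // imset_f.
rewrite det_1_plus_mulmxC; congr (\det _); apply/matrixP=> a b; rewrite !mxE.
rewrite (bigD1 (t b)) //= !mxE eqxx mulr1 big1 ?addr0; last first.
  by move=> j jb; rewrite !mxE (negPf jb) mulr0.
by rewrite (inj_eq inj_t) addrC subrK.
Qed.

(** Each factor of a Leibniz product is a monomial term plus a constant. Distributing the product,
    [S] is the set of rows where the monomial is chosen. *)
Lemma det_1_sub_diag_mul m (d : 'I_m -> nat) (K : 'M[int]_m) :
  \det (1%:M - diag_mx (\row_i 'X^(d i)) *m map_mx polyC K) =
  \sum_(S : {set 'I_m}) (\det (row_mix K S)) *: 'X^(\sum_(i in S) d i).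
Proof.
have termE (s : 'S_m) :
    \prod_i (1%:M - diag_mx (\row_i 'X^(d i)) *m map_mx polyC K) i (s i) =
    \sum_(S : {set 'I_m}) (\prod_i row_mix K S i (s i)) *: 'X^(\sum_(i in S) d i).
  transitivity (\prod_i ((- K i (s i)) *: 'X^(d i) + ((i == s i)%:R : int)%:P)).
    apply: eq_bigr => i _; rewrite mul_diag_mx !mxE addrC scaleNr.
    by rewrite mulrC mul_polyC rmorph_nat.
  rewrite bigA_distr; apply: eq_bigr => S _.
  rewrite -mul_polyC rmorph_prod expr_sum /=.
  rewrite [\prod_(i in S) _]big_mkcond -big_split /=.
  apply: eq_bigr => i _; rewrite mxE.
  by case: ifP => _; rewrite ?mulr1 // mul_polyC.
rewrite {1}/determinant; under eq_bigr => s _ do rewrite termE mulr_sumr.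
rewrite exchange_big /=; apply: eq_bigr => S _.
rewrite scaler_suml; apply: eq_bigr => s _.
rewrite -scalerA [RHS]scaler_sign.
by case: (odd_perm s); rewrite ?expr1 ?expr0 ?mulN1r ?mul1r.
Qed.

(** Minors are indexed by injections rather than subsets, so that those of size 2 and 3 are
    instances at explicit tuples. The sign is inherited from [det_row_mix]. *)
Definition same_minors m (K K' : 'M[int]_m) :=
  forall r (t : 'I_r -> 'I_m), injective t ->
  \det (- mxsub t t K) = \det (- mxsub t t K').

Lemma same_minors_of_det m (K K' : 'M[int]_m) :
  \det (1%:M - diag_mx (\row_(i < m) 'X^(2 ^ i)) *m map_mx polyC K) =
  \det (1%:M - diag_mx (\row_(i < m) 'X^(2 ^ i)) *m map_mx polyC K') ->
  same_minors K K'.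
Proof.
move=> eqKK' r t inj_t; rewrite -!det_row_mix //.
move/(congr1 (fun p : {poly int} => p`_(\sum_(i in t @: setT) 2 ^ i)%N)): eqKK'.
rewrite !(det_1_sub_diag_mul (fun i => 2 ^ i)%N) !coef_sumMXn.
have pick1 : (fun S : {set 'I_m} =>
    \sum_(i in S) 2 ^ i == \sum_(i in t @: setT) 2 ^ i)%N =1 pred1 (t @: setT).
  by move=> S /=; apply: (inj_eq (@subset_sum_expn2_inj m)).
by rewrite !(eq_bigl _ _ pick1) !big_pred1_eq.
Qed.

Lemma det_mx22 (R : comNzRingType) (A : 'M[R]_2) :
  \det A = A 0 0 * A 1 1 - A 0 1 * A 1 0.
Proof.
rewrite (expand_det_row _ 0) !big_ord_recl big_ord0 /cofactor !det_mx11 !mxE /=.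
rewrite addr0 expr0 expr1 mul1r mulN1r mulrN.
by congr (_ * A _ _ - A _ _ * A _ _); apply: val_inj.
Qed.

Lemma det_mx33 (R : comNzRingType) (A : 'M[R]_3) :
  \det A = A 0 0 * (A 1 1 * A 2 2 - A 1 2 * A 2 1)
         - A 0 1 * (A 1 0 * A 2 2 - A 1 2 * A 2 0)
         + A 0 2 * (A 1 0 * A 2 1 - A 1 1 * A 2 0).
Proof.
(* With entries indexed by natural numbers, the nested lifts of the cofactor expansion compute to
   numerals. *)
pose a (i j : nat) := A (inord i) (inord j).
have aE i j : A i j = a i j by rewrite /a !inord_val.
rewrite (expand_det_row _ 0) !big_ord_recl big_ord0 /cofactor !det_mx22 !mxE !aE /=.
by rewrite /bump /= expr0 expr1 sqrrN expr1n; ring.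
Qed.

(** * Matching vertices by their incident edges *)

Definition star (V : finType) m (s : 'I_m -> {set V}) (v : V) : {set 'I_m} :=
  [set i | v \in s i].

(** Downward induction on the size of [S]: the vertices whose star contains [S] split into those
    with star [S] and those with a strictly larger star. *)
Lemma card_star_eq (V V' : finType) m (s : 'I_m -> {set V}) (s' : 'I_m -> {set V'}) :
  (forall S : {set 'I_m}, #|[set v | S \subset star s v]| =
     #|[set v | S \subset star s' v]|) ->
  forall S, #|[set v | star s v == S]| = #|[set v | star s' v == S]|.
Proof.
have splitE (U : finType) (u : 'I_m -> {set U}) (S : {set 'I_m}) :
    (#|[set v | S \subset star u v]| = #|[set v | star u v == S]| +
       \sum_(T : {set 'I_m} | S \proper T) #|[set v | star u v == T]|)%N.
  have E (T : {set 'I_m}) : #|[set v | star u v == T]| = (\sum_v (star u v == T))%N.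
    by rewrite -sum1dep_card big_mkcond; apply: eq_bigr => v _; case: eqP.
  under eq_bigr do rewrite E.
  rewrite E exchange_big -big_split /= -sum1dep_card big_mkcond.
  apply: eq_bigr => v _; have [->|neS] := eqVneq (star u v) S.
    by rewrite subxx big1 // => T /properP[_ [x xT xS]]; case: eqP xS xT => // -> /negP.
  rewrite add0n subEproper eq_sym (negPf neS) /=.
  case: ifP => ltS; last by rewrite big1 // => T; case: eqP => // <-; rewrite ltS.
  by rewrite (bigD1 (star u v)) //= eqxx big1 // => T /andP[_ /negPf]; rewrite eq_sym => ->.
move=> supE S; have [k] := ubnP (m - #|S|).
elim: k S => [//|k IHk] S leSk.
have /eqP := supE S; rewrite !splitE.
rewrite (eq_bigr (fun T => #|[set v | star s' v == T]|)); first by rewrite eqn_add2r => /eqP.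
move=> T /proper_card ltST; apply: IHk; have := max_card T; rewrite card_ord; lia.
Qed.

(** Corresponding fibres have the same size, so [f] sends the element at a given position in a fibre
    of [g] to the element at the same position in the fibre of [h]. *)
Lemma fiber_bijection (A B : finType) (C : eqType) (g : A -> C) (h : B -> C) :
  (forall c, #|[set a | g a == c]| = #|[set b | h b == c]|) ->
  #|A| = #|B| ->
  exists2 f : A -> B, bijective f & forall a, h (f a) = g a.
Proof.
move=> eq_fib cardAB.
have /fin_all_exists[f fP] a : exists b, h b = g a /\
    index b (enum [set b | h b == g a]) = index a (enum [set x | g x == g a]).
  have ina : a \in enum [set x | g x == g a] by rewrite mem_enum inE.
  have lt_ia : (index a (enum [set x | g x == g a]) < size (enum [set b | h b == g a]))%N.
    by rewrite -cardE -eq_fib cardE index_mem.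
  (* The position is below the size of the target fibre, which is thus nonempty and supplies the
     default for [nth]. *)
  have [b0 _] : exists b0 : B, true.
    by case: (enum [set b | h b == g a]) lt_ia => // b0; exists b0.
  exists (nth b0 (enum [set b | h b == g a]) (index a (enum [set x | g x == g a]))).
  have := mem_nth b0 lt_ia; rewrite mem_enum inE => /eqP ->.
  by rewrite index_uniq ?enum_uniq.
exists f => [|a]; last by case: (fP a).
apply: inj_card_bij; last by rewrite cardAB.
move=> a a' eq_f; have [hfa ia] := fP a; have [hfa' ia'] := fP a'.
have eq_g : g a = g a' by rewrite -hfa -hfa' eq_f.
move: ia'; rewrite -eq_f -eq_g ia => eq_i.
have ina x : g x = g a -> x \in enum [set x | g x == g a] by rewrite mem_enum inE => ->.
by rewrite -(nth_index a (ina a erefl)) eq_i nth_index // ina.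
Qed.

(** * Inner products of signed edge vectors *)

(* The column of [e] in an oriented incidence matrix; the orientation is the
   arbitrary one singling out the vertex [pick] returns. *)
Definition edge_sign (V : finType) (e : {set V}) (a : V) : int :=
  if a \in e then (-1) ^+ ([pick x in e] == Some a) else 0.

Definition edge_dot (V : finType) (e f : {set V}) : int :=
  \sum_a edge_sign e a * edge_sign f a.

Section EdgeSign.
Variable V : finType.
Implicit Types (e f g : {set V}) (a b v : V).

Lemma edge_dotC e f : edge_dot e f = edge_dot f e.
Proof. by apply: eq_bigr => a _; rewrite mulrC. Qed.

Lemma edge_sign_sqr e a : a \in e -> edge_sign e a * edge_sign e a = 1.
Proof. by rewrite /edge_sign => ->; rewrite -expr2 sqrr_sign. Qed.

Lemma edge_sign_mul e a b : #|e| = 2%N -> a \in e -> b \in e -> a != b ->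
  edge_sign e a * edge_sign e b = -1.
Proof.
move=> card_e ae be ab; rewrite /edge_sign ae be.
have {card_e} eE : e = [set a; b].
  apply/esym/eqP; rewrite eqEcard card_e cards2 ab leqnn andbT.
  by apply/subsetP => x /set2P[] ->.
(* [pick] returns one of the two endpoints, so exactly one of the two signs is -1. *)
case: pickP => [x|/(_ a)]; last by rewrite ae.
have Some_eq (y z : V) : (Some y == Some z) = (y == z) by [].
rewrite eE => /set2P[] ->; rewrite !Some_eq !eqxx ?(negPf ab) 1?eq_sym ?(negPf ab).
  by rewrite expr0 mulr1.
by rewrite expr0 mul1r.
Qed.

Lemma edge_dot_self e : #|e| = 2%N -> edge_dot e e = 2.
Proof.
move=> card_e; rewrite /edge_dot -[RHS]/(2%N%:R) -card_e -sum1_card natr_sum.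
rewrite [RHS]big_mkcond; apply: eq_bigr => a _.
by case: ifP => [/edge_sign_sqr //|ae]; rewrite /edge_sign ae mul0r.
Qed.

Lemma edge_dot_disjoint e f : e :&: f = set0 -> edge_dot e f = 0.
Proof.
move=> ef0; rewrite /edge_dot big1 // => a _; rewrite /edge_sign.
have := in_set0 a; rewrite -ef0 inE.
by case: (a \in e); case: (a \in f); rewrite ?mul0r ?mulr0.
Qed.

Lemma edge_cap1 e f v : #|e| = 2%N -> #|f| = 2%N -> e != f ->
  v \in e -> v \in f -> e :&: f = [set v].
Proof.
move=> card_e card_f ef ve vf; apply/esym/eqP.
rewrite eqEcard cards1 sub1set inE ve vf /= leqNgt.
apply: contra ef => cap2; have capE : e :&: f = e.
  by apply/eqP; rewrite eqEcard subsetIl card_e.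
by rewrite eqEcard card_e card_f leqnn andbT; apply/setIidPl.
Qed.

Lemma edge_dot_cap1 e f v : #|e| = 2%N -> #|f| = 2%N -> e != f ->
  v \in e -> v \in f -> edge_dot e f = edge_sign e v * edge_sign f v.
Proof.
move=> card_e card_f ef ve vf; have capE := edge_cap1 card_e card_f ef ve vf.
rewrite /edge_dot (bigD1 v) //= big1 ?addr0 // => a av; rewrite /edge_sign.
have := in_set1 a v; rewrite -capE inE (negPf av).
by case: (a \in e); case: (a \in f); rewrite ?mul0r ?mulr0.
Qed.

(** Distinct edges share at most one vertex, and a shared one contributes 1 or -1 depending on the
    orientation; squaring removes that sign. *)
Lemma edge_dot_eq0 e f : #|e| = 2%N -> #|f| = 2%N -> e != f ->
  (edge_dot e f ^+ 2 == 0) = (e :&: f == set0).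
Proof.
move=> card_e card_f ef; apply/idP/eqP => [|/edge_dot_disjoint->]; last by rewrite expr0n.
have [//|[v /setIP[ve vf]]] := set_0Vmem (e :&: f).
rewrite (edge_dot_cap1 card_e card_f ef ve vf) exprMn !expr2.
by rewrite !edge_sign_sqr.
Qed.

(* At a common vertex each sign occurs twice in the product; around a triangle
   each edge contributes its two opposite signs, giving -1. *)
Lemma edge_dot_triple e f g : #|e| = 2%N -> #|f| = 2%N -> #|g| = 2%N ->
  e != f -> f != g -> e != g ->
  (edge_dot e f * edge_dot f g * edge_dot e g == 1) = (e :&: f :&: g != set0).
Proof.
move=> ce cf cg ef fg eg; rewrite (edge_dotC e g); have ge : g != e by rewrite eq_sym.
have [efg0|[v /setIP[/setIP[ve vf] vg]]] := set_0Vmem (e :&: f :&: g); last first.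
  rewrite (edge_dot_cap1 ce cf ef ve vf) (edge_dot_cap1 cf cg fg vf vg).
  rewrite (edge_dot_cap1 cg ce ge vg ve).
  have -> : edge_sign e v * edge_sign f v * (edge_sign f v * edge_sign g v) *
     (edge_sign g v * edge_sign e v) = (edge_sign e v * edge_sign e v) *
     (edge_sign f v * edge_sign f v) * (edge_sign g v * edge_sign g v) by ring.
  by rewrite !edge_sign_sqr // eqxx; apply/esym/set0Pn; exists v; rewrite !inE ve vf vg.
rewrite efg0 eqxx /=.
have [/edge_dot_disjoint->|[a /setIP[ae af]]] := set_0Vmem (e :&: f); first by rewrite !mul0r.
have [/edge_dot_disjoint->|[b /setIP[bf bg]]] := set_0Vmem (f :&: g).
  by rewrite mulr0 mul0r.
have [/edge_dot_disjoint->|[c /setIP[c_g c_e]]] := set_0Vmem (g :&: e); first by rewrite mulr0.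
(* Edges that meet pairwise without a common vertex meet in three distinct vertices, hence form a
   triangle. *)
have noefg x : x \in e -> x \in f -> x \in g -> False.
  by move=> xe xf xg; have := in_set0 x; rewrite -efg0 !inE xe xf xg.
have ac : a != c by apply/eqP=> eqx; apply: (noefg a); rewrite // eqx.
have ab : a != b by apply/eqP=> eqx; apply: (noefg a); rewrite // eqx.
have bc : b != c by apply/eqP=> eqx; apply: (noefg b); rewrite // eqx.
rewrite (edge_dot_cap1 ce cf ef ae af) (edge_dot_cap1 cf cg fg bf bg).
rewrite (edge_dot_cap1 cg ce ge c_g c_e).
have -> : edge_sign e a * edge_sign f a * (edge_sign f b * edge_sign g b) *
   (edge_sign g c * edge_sign e c) = (edge_sign e a * edge_sign e c) *
   (edge_sign f a * edge_sign f b) * (edge_sign g b * edge_sign g c) by ring.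
by rewrite !edge_sign_mul.
Qed.

End EdgeSign.

(** * Incidences recovered from the Gram matrix *)

Definition edge_gram (V : finType) m (s : 'I_m -> {set V}) : 'M[int]_m :=
  \matrix_(i, j) edge_dot (s i) (s j).

(** With off-diagonal entries x, y, z, the principal minors are 4 - x^2 in size 2 and 8 + 2xyz -
    2(x^2 + y^2 + z^2) in size 3. The former give the squares, and then the latter give xyz, which
    [edge_dot_triple] interprets. *)
Lemma gram_cap3 (V V' : finType) m (s : 'I_m -> {set V}) (s' : 'I_m -> {set V'}) :
  injective s -> injective s' ->
  (forall i, #|s i| = 2%N) -> (forall i, #|s' i| = 2%N) ->
  same_minors (edge_gram s) (edge_gram s') ->
  forall i j k, i != j ->
    (s i :&: s j :&: s k == set0) = (s' i :&: s' j :&: s' k == set0).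
Proof.
move=> inj_s inj_s' card_s card_s' minors.
have sqr i j : i != j -> edge_dot (s i) (s j) ^+ 2 = edge_dot (s' i) (s' j) ^+ 2.
  move=> ij; have inj_t : injective (tnth [tuple i; j]) by apply/tuple_uniqP; rewrite /= inE ij.
  have := minors _ _ inj_t; rewrite !det_mx22 !mxE /tnth /= !edge_dot_self //.
  rewrite (edge_dotC (s j)) (edge_dotC (s' j)); lia.
have pair i j : i != j -> (s i :&: s j == set0) = (s' i :&: s' j == set0).
  by move=> ij; rewrite -!edge_dot_eq0 ?sqr // ?(inj_eq inj_s) ?(inj_eq inj_s').
move=> i j k ij.
(* [k] may repeat [i] or [j], as [card_common] lets it range over all of [S]; the claim is then the
   pairwise one. *)
have [<-|ki] := eqVneq i k; first by rewrite setIAC setIid [in RHS]setIAC setIid pair.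
have [<-|kj] := eqVneq j k; first by rewrite -!setIA !setIid pair.
apply: negb_inj; rewrite -!edge_dot_triple ?(inj_eq inj_s) ?(inj_eq inj_s') //.
suff -> : edge_dot (s i) (s j) * edge_dot (s j) (s k) * edge_dot (s i) (s k) =
  edge_dot (s' i) (s' j) * edge_dot (s' j) (s' k) * edge_dot (s' i) (s' k) by [].
have inj_t : injective (tnth [tuple i; j; k]).
  by apply/tuple_uniqP; rewrite /= !inE negb_or ij ki kj.
have := minors _ _ inj_t; rewrite !det_mx33 !mxE /tnth /= !edge_dot_self //.
have := sqr _ _ ij; have := sqr _ _ ki; have := sqr _ _ kj.
rewrite !(edge_dotC (s j) (s i)) !(edge_dotC (s' j) (s' i)).
rewrite !(edge_dotC (s k)) !(edge_dotC (s' k)).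
set x := edge_dot (s i) (s j); set y := edge_dot (s j) (s k); set z := edge_dot (s i) (s k).
set x' := edge_dot (s' i) (s' j); set y' := edge_dot (s' j) (s' k).
set z' := edge_dot (s' i) (s' k).
by move=> *; lia.
Qed.

(** Two distinct edges of [S] meet in at most one vertex, so the count is 0 or 1, and triple
    intersections decide which. *)
Lemma card_common (V : finType) m (s : 'I_m -> {set V}) (S : {set 'I_m}) i j :
  injective s -> (forall i, #|s i| = 2%N) -> i \in S -> j \in S -> i != j ->
  #|[set v | S \subset star s v]| = [forall k in S, s i :&: s j :&: s k != set0].
Proof.
move=> inj_s card_s iS jS ij.
have sub_cap v : (S \subset star s v) -> v \in s i :&: s j.
  by move/subsetP=> sub; have := sub i iS; have := sub j jS; rewrite !inE => -> ->.
case: forall_inP => [cap3|no_cap].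
  have [v vij] := set0Pn _ (cap3 i iS); move: (vij); rewrite !inE => /andP[/andP[vi vj] _].
  have capE : s i :&: s j = [set v] by apply: edge_cap1; rewrite ?(inj_eq inj_s).
  rewrite (_ : [set _ | _] = [set v]) ?cards1 //; apply/setP=> w; rewrite !inE.
  apply/idP/eqP => [/sub_cap|->]; first by rewrite capE inE => /eqP.
  apply/subsetP=> k kS; have := cap3 k kS; rewrite inE capE => /set0Pn[x].
  by rewrite !inE => /andP[/eqP->].
rewrite (_ : [set _ | _] = set0) ?cards0 //; apply/setP=> w; rewrite !inE.
apply/negbTE/negP=> Sw; case: no_cap => k kS; apply/set0Pn; exists w.
by rewrite inE sub_cap //=; have := subsetP Sw k kS; rewrite inE.
Qed.

Lemma gram_bijection (V V' : finType) m (s : 'I_m -> {set V}) (s' : 'I_m -> {set V'}) :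
  #|V| = #|V'| -> injective s -> injective s' ->
  (forall i, #|s i| = 2%N) -> (forall i, #|s' i| = 2%N) ->
  same_minors (edge_gram s) (edge_gram s') ->
  exists2 f : V -> V', bijective f & forall i v, (f v \in s' i) = (v \in s i).
Proof.
move=> cardV inj_s inj_s' card_s card_s' minors.
have cap3 := gram_cap3 inj_s inj_s' card_s card_s' minors.
have [|//|f bij_f starE] := @fiber_bijection V V' _ (star s) (star s'); last first.
  by exists f => // i v; have /setP/(_ i) := starE v; rewrite !inE.
(* The count for [S] is the number of vertices if [S] is empty, 2 if it is a singleton, and given by
   triple intersections otherwise. *)
apply: card_star_eq => S; case: (ltngtP #|S| 1) => [|/card_gt1P[i [j [iS jS ij]]]|].
- rewrite ltnS leqn0 cards_eq0 => /eqP->.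
  have E (U : finType) (u : 'I_m -> {set U}) : #|[set v | set0 \subset star u v]| = #|U|.
    by rewrite -cardsT; apply: eq_card => v; rewrite !inE sub0set.
  by rewrite !E.
- rewrite !(card_common (i := i) (j := j)) //; congr (nat_of_bool _).
  by apply: eq_forallb => k; rewrite cap3.
move/eqP/cards1P=> [i ->].
have E (U : finType) (u : 'I_m -> {set U}) : #|[set v | [set i] \subset star u v]| = #|u i|.
  by apply: eq_card => v; rewrite !inE sub1set inE.
by rewrite !E card_s card_s'.
Qed.

(** * Edges and the Laplacian *)

Lemma card_edge (G : sgraph) (e : {set G}) : e \in edges G -> #|e| = 2%N.
Proof.
rewrite inE => /existsP[x /existsP[y /andP[xy /eqP->]]]; rewrite cards2.
by case: eqP xy => // ->; rewrite adj_irrefl.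
Qed.

Lemma pair_in_edges (G : sgraph) (x y : G) : ([set x; y] \in edges G) = adj x y.
Proof.
apply/idP/idP => [xyG|xy]; last first.
  by rewrite inE; apply/existsP; exists x; apply/existsP; exists y; rewrite xy /=.
have := card_edge xyG; rewrite cards2; case: eqVneq => // xy _.
move: xyG; rewrite inE => /existsP[a /existsP[b /andP[ab /eqP eqab]]].
have: x \in [set a; b] by rewrite -eqab set21.
have: y \in [set a; b] by rewrite -eqab set22.
by move: xy => /[swap] /set2P[] -> /[swap] /set2P[] ->; rewrite ?eqxx // adj_sym.
Qed.

Lemma edge_pair (G : sgraph) (e : {set G}) (x y : G) :
  e \in edges G -> x != y -> x \in e -> y \in e -> e = [set x; y].
Proof.
move=> /card_edge card_e xy xe ye; apply/esym/eqP.
by rewrite eqEcard card_e cards2 xy subUset !sub1set xe ye.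
Qed.

Section EnumeratedEdges.
Variables (G : sgraph) (D : diffusion G) (m : nat) (s : 'I_m -> {set G}).
Hypotheses (inj_s : injective s) (s_edges : s @: setT = edges G).

Lemma enum_edge_in i : s i \in edges G.
Proof. by rewrite -s_edges imset_f. Qed.

Lemma adj_enum x y : adj x y = (x != y) && [exists i, (x \in s i) && (y \in s i)].
Proof.
have [<-|xy] := eqVneq x y; first by rewrite adj_irrefl.
apply/idP/existsP => [|[i /andP[xi yi]]].
  rewrite -pair_in_edges -s_edges => /imsetP[i _ eq_i].
  by exists i; rewrite -eq_i !inE !eqxx orbT.
by rewrite -pair_in_edges -(edge_pair (enum_edge_in i) xy xi yi) enum_edge_in.
Qed.

Lemma big_edges (R : nmodType) (P : pred {set G}) (F : {set G} -> R) :
  \sum_(e in edges G | P e) F e = \sum_(i | P (s i)) F (s i).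
Proof.
rewrite big_mkcondr -s_edges big_imset /=; last by move=> i j _ _ /inj_s.
by rewrite -big_mkcondr; apply: eq_bigl => i; rewrite inE.
Qed.

(** This is an entry of B W B^T. On the diagonal the signs square to 1; off it, only the edge
    joining [a] and [b] contributes, with opposite signs. *)
Lemma lap_entry_enum a b : lap_entry D a b =
  \sum_i (edge_sign (s i) a * edge_sign (s i) b) *: 'X^(D (s i)).
Proof.
rewrite /lap_entry; have [<-|ab] := eqVneq a b.
  rewrite (big_edges (fun e => a \in e)) big_mkcond; apply: eq_bigr => i _.
  case: ifP => [/edge_sign_sqr->|ai]; first by rewrite scale1r.
  by rewrite /edge_sign ai mul0r scale0r.
have zero i : ~~ ((a \in s i) && (b \in s i)) -> edge_sign (s i) a * edge_sign (s i) b = 0.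
  by rewrite /edge_sign; case: (a \in s i); case: (b \in s i); rewrite ?mul0r ?mulr0.
rewrite adj_enum ab /=; case: existsP => [[i /andP[ai bi]]|no_i].
  have eq_i := edge_pair (enum_edge_in i) ab ai bi.
  rewrite (bigD1 i) //= edge_sign_mul ?card_edge ?enum_edge_in // -eq_i scaleN1r.
  rewrite big1 ?addr0 // => j ji; rewrite zero ?scale0r //.
  apply: contra ji => /andP[aj bj]; rewrite -(inj_eq inj_s) eq_i.
  by rewrite -(edge_pair (enum_edge_in j) ab aj bj).
rewrite big1 // => i _; rewrite zero ?scale0r //.
by apply/negP=> abi; apply: no_i; exists i.
Qed.

Lemma trace_laplacian : \tr (laplacian D) = \sum_i 2 *: 'X^(D (s i)).
Proof.
rewrite /mxtrace; under eq_bigr do rewrite mxE lap_entry_enum.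
rewrite exchange_big; apply: eq_bigr => i _ /=; rewrite -scaler_suml.
rewrite -(edge_dot_self (card_edge (enum_edge_in i))) /edge_dot.
by rewrite [in RHS](reindex _ (onW_bij _ (enum_val_bij G))).
Qed.

Lemma det_1_sub_laplacian :
  \det (1%:M - laplacian D) =
  \det (1%:M - diag_mx (\row_i 'X^(D (s i))) *m map_mx polyC (edge_gram s)).
Proof.
pose B : 'M[int]_(#|G|, m) := \matrix_(a, i) edge_sign (s i) (enum_val a).
pose W : 'M[{poly int}]_m := diag_mx (\row_i 'X^(D (s i))).
have -> : laplacian D = map_mx polyC B *m (W *m map_mx polyC B^T).
  apply/matrixP=> a b; rewrite !mxE lap_entry_enum; apply: eq_bigr => i _.
  rewrite mul_diag_mx !mxE -mul_polyC polyCM -mulrA.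
  by rewrite (mulrC (polyC (edge_sign (s i) (enum_val b)))).
have -> : edge_gram s = B^T *m B.
  apply/matrixP=> i j; rewrite !mxE /edge_dot (reindex _ (onW_bij _ (enum_val_bij G))).
  by apply: eq_bigr => a _; rewrite !mxE.
by rewrite -mulNmx det_1_plus_mulmxC mulmxN map_mxM mulmxA.
Qed.

End EnumeratedEdges.

(** * Spectral polynomials and isomorphism *)

Lemma spectral_poly_iso (G G' : sgraph) (D : diffusion G) (D' : diffusion G') :
  diffusion_iso D D' -> spectral_poly D = spectral_poly D'.
Proof.
case=> f [bij_f adj_f D_f]; have inj_f := bij_inj bij_f.
have inj_fset : injective (fun e : {set G} => f @: e) := imset_inj inj_f.
have edges_f : edges G' = [set f @: (e : {set G}) | e in edges G].
  have [g fK gK] := bij_f.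
  apply/setP=> e; apply/idP/imsetP => [|[e0 e0G ->]].
    rewrite inE => /existsP[x /existsP[y /andP[xy /eqP->]]].
    exists [set g x; g y]; last by rewrite imsetU1 imset_set1 !gK.
    by rewrite pair_in_edges -adj_f !gK.
  move: e0G; rewrite inE => /existsP[x /existsP[y /andP[xy /eqP->]]].
  by rewrite imsetU1 imset_set1 pair_in_edges adj_f.
apply: (@char_poly_reindex _ _ _ _ _ (fun i => enum_rank (f (enum_val i)))).
  apply: bij_comp; first exact: enum_rank_bij.
  by apply: bij_comp => //; apply: enum_val_bij.
move=> i j; rewrite !mxE !enum_rankK /lap_entry (inj_eq inj_f) adj_f.
set a := enum_val i; set b := enum_val j.
case: eqP => _.
  rewrite big_mkcondr edges_f big_imset; last by move=> ? ? _ _ /inj_fset.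
  rewrite [RHS]big_mkcondr; apply: eq_bigr => e eG /=.
  by rewrite mem_imset // D_f.
case: ifP => // ab; rewrite -D_f ?pair_in_edges // imsetU1 imset_set1 //.
Qed.

Lemma diffusion_of_spectral_poly (G G' : sgraph) (D : diffusion G) (D' : diffusion G')
    m (s : 'I_m -> {set G}) :
  injective s -> s @: setT = edges G -> (forall i, D (s i) = 2 ^ i)%N ->
  spectral_poly D = spectral_poly D' -> diffusion_iso D D'.
Proof.
move=> inj_s s_edges Ds eqP.
have cardG : #|G| = #|G'| := char_poly_dim eqP.
have trE : \tr (laplacian D) = \tr (laplacian D').
  move: eqP; rewrite /spectral_poly; move: (laplacian D) (laplacian D').
  by case: _ / cardG => A B; apply: mxtrace_char_poly.
pose s0 := @enum_val _ (mem (edges G')).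
have inj_s0 : injective s0 := enum_val_inj.
have s0_edges : s0 @: setT = edges G'.
  apply/setP=> e; apply/imsetP/idP => [[i _ ->]|eG']; first exact: enum_valP.
  by exists (enum_rank_in eG' e); rewrite // /s0 enum_rankK_in.
(* The coefficient of Y^k in the trace is twice the number of edges with parameter k. *)
have count_param k : #|[set i | D (s i) == k]| = #|[set i | D' (s0 i) == k]|.
  move: trE; rewrite (trace_laplacian D inj_s s_edges) (trace_laplacian D' inj_s0 s0_edges).
  move/(congr1 (fun p : {poly int} => p`_k)); rewrite !coef_sumMXn !sumr_const.
  move/(mulrIn (isT : 2 != 0 :> int)) => eqk.
  exact: etrans (cardsE _) (etrans eqk (esym (cardsE _))).
have [|h bij_h hD] := fiber_bijection count_param.
  (* At Y = 1 the trace is twice the number of edges, so the two index types have equal size. *)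
  move: trE; rewrite (trace_laplacian D inj_s s_edges) (trace_laplacian D' inj_s0 s0_edges).
  move/(congr1 (fun p : {poly int} => p.[1])); rewrite !horner_sum.
  under eq_bigr do rewrite hornerZ hornerXn expr1n mulr1.
  under [RHS]eq_bigr do rewrite hornerZ hornerXn expr1n mulr1.
  by rewrite !sumr_const => /(mulrIn (isT : 2 != 0 :> int)).
(* The edges of [G'] are renumbered so that edge [i] has parameter [2 ^ i], as in [G]. *)
pose s' i := s0 (h i).
have inj_s' : injective s' := inj_comp inj_s0 (bij_inj bij_h).
have s'_edges : s' @: setT = edges G'.
  have h_onto : h @: setT = setT.
    by have [g _ gK] := bij_h; apply/setP=> i; rewrite inE -(gK i) imset_f.
  by rewrite -s0_edges -h_onto -imset_comp.
have D's' i : (D' (s' i) = 2 ^ i)%N by rewrite hD.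
have minors : same_minors (edge_gram s) (edge_gram s').
  apply: same_minors_of_det.
  have rowE (H : sgraph) (E : diffusion H) (u : 'I_m -> {set H}) :
      (forall i, E (u i) = 2 ^ i)%N ->
      \row_(i < m) 'X^(2 ^ i) = \row_(i < m) 'X^(E (u i)) :> 'rV[{poly int}]_m.
    by move=> Eu; apply/rowP=> i; rewrite !mxE Eu.
  rewrite {1}(rowE _ _ _ Ds) (rowE _ _ _ D's') -!det_1_sub_laplacian //.
  (* Both determinants are values of the spectral polynomials at X = 1. *)
  by rewrite -!horner_char_poly -/(spectral_poly D) eqP.
have [f bij_f fs] := gram_bijection cardG inj_s inj_s'
  (fun i => card_edge (enum_edge_in s_edges i))
  (fun i => card_edge (enum_edge_in s'_edges i)) minors.
exists f; split=> // [x y|e].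
  rewrite (adj_enum s'_edges) (adj_enum s_edges) (inj_eq (bij_inj bij_f)).
  by congr (_ && _); apply: eq_existsb => i; rewrite !fs.
rewrite -s_edges => /imsetP[i _ ->]; rewrite Ds -D's'; congr (D' _).
have [g fK gK] := bij_f; apply/setP=> y; rewrite -(gK y) fs mem_imset //.
exact: bij_inj.
Qed.

Theorem theorem4p7 (G : sgraph) :
  exists D : diffusion G,
    forall (G' : sgraph) (D' : diffusion G'),
      spectral_poly D = spectral_poly D' <-> diffusion_iso D D'.
Proof.
have param_gt0 (e : {set G}) : e \in edges G -> (0 < 2 ^ index e (enum (edges G)))%N.
  by rewrite expn_gt0.
exists (Diffusion param_gt0) => G' D'; split; last exact: spectral_poly_iso.
apply: (@diffusion_of_spectral_poly _ _ _ _ _ (@enum_val _ (mem (edges G)))).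
- exact: enum_val_inj.
- apply/setP=> e; apply/imsetP/idP => [[i _ ->]|eG]; first exact: enum_valP.
  by exists (enum_rank_in eG e); rewrite // enum_rankK_in.
(* The enumeration has no duplicates, so the edge at position [i] has index [i] and parameter
   [2 ^ i]. *)
move=> i /=; rewrite (enum_val_nth set0) index_uniq ?enum_uniq //.
by rewrite -cardE.
Qed.
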